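(* Let $m\ge 1$ be an integer, let $k\in\mathbb{Z}$ and let $z\in\mathbb{C}\setminus\{0\}$. The sequence $$a(n,m,k,z)=\sum_{j\in\mathbb{Z}}z^j\binom{n}{\left\lfloor\frac{n-mj+k}{2}\right\rfloor},\qquad n\in\mathbb{N},$$ satisfies the recurrence relation $$\left(L_m(E,-1)-\left(z+\frac1z\right)\right)a(n,m,k,z)=0\quad\text{for all } n\in\mathbb{N}.$$
   Context: $\mathbb{N}=\{0,1,2,\dots\}$. For $n\in\mathbb{N}$ and $i\in\mathbb{Z}$, $\binom{n}{i}$ is the usual binomial coefficient, equal to $0$ if $i<0$ or $i>n$; hence the sum over $j$ has only finitely many nonzero terms. $\lfloor\cdot\rfloor$ is the floor function. The Lucas polynomials $L_n(x,s)$ are defined by $L_0(x,s)=2$, $L_1(x,s)=x$ and $L_n(x,s)=xL_{n-1}(x,s)+sL_{n-2}(x,s)$ for $n\ge2$; for $n\ge1$, $L_n(x,s)=\sum_{k=0}^{n-1}\binom{n-k}{k}\frac{n}{n-k}s^kx^{n-2k}$ (terms with zero binomial coefficient being omitted). $E$ is the shift operator in the variable $n$: for a polynomial $p(x)=\sum_{i=0}^{d}a_ix^i$ and a function $f$ of $n\in\mathbb{N}$ (possibly depending on further parameters, which are kept fixed), $p(E)f(n)=\sum_{i=0}^{d}a_if(n+i)$. Here $L_m(E,-1)$ denotes $p(E)$ for $p(x)=L_m(x,-1)$, and the scalar $z+\frac1z$ acts by multiplication. *)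

(* Defs.v *)
From mathcomp Require Import all_boot all_order all_algebra.
From mathcomp Require Import all_classical all_reals.
From mathcomp Require Import zify.
Set Implicit Arguments.
Unset Strict Implicit.
Unset Printing Implicit Defensive.
Import Order.TTheory GRing.Theory Num.Theory.
Local Open Scope ring_scope.

Fixpoint lucas (A : comNzRingType) (x s : A) (n : nat) : A :=
  match n with
  | 0 => 2
  | 1 => x
  | (n'.+1 as n1).+1 => x * lucas x s n1 + s * lucas x s n'
  end.

Definition shift_op (A : comNzRingType) (p : {poly A}) (f : nat -> A) : nat -> A :=
  fun n => \sum_(i < size p) p`_i * f (n + i)%N.

Definition binz (n : nat) (i : int) : nat :=
  if i is Posz l then 'C(n, l) else 0%N.

Definition lucas_binom_term (F : fieldType) (m : nat) (k : int) (z : F)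
    (n : nat) (j : int) : F :=
  z ^ j * (binz n (Num.floor ((n%:Z - m%:Z * j + k)%:~R / 2 : rat)))%:R.

(* [\sum_(j \in A) u j] is 0 by convention when u has infinite support in A;
   by [lucas_binom_term_finite] this never happens for m > 0. *)
Definition lucas_binom (F : fieldType) (m : nat) (k : int) (z : F) (n : nat) : F :=
  \sum_(j \in [set: int]) lucas_binom_term m k z n j.

Lemma lucas_binom_term_finite (F : fieldType) (m : nat) (k : int) (z : F)
    (n : nat) : (0 < m)%N ->
  finite_set [set j | lucas_binom_term m k z n j != 0].
Proof.
move=> m_gt0.
pose N := (3 * n + 2 + `|k|)%N.
pose s : seq int := [seq i%:Z - N%:Z | i <- iota 0 (2 * N).+1].
apply: (@sub_finite_set _ _ [set` s]); last exact: finite_seq.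
move=> j /=; rewrite /lucas_binom_term /binz; set x := n%:Z - _ + _.
have /andP[] := floor_itv (x%:~R / 2 : rat).
rewrite ler_pdivlMr// ltr_pdivrMr//.
case: Num.floor => l; last by rewrite mulr0 eqxx.
have [l_le_n|n_lt_l] := leqP l n; last by rewrite bin_small// mulr0 eqxx.
rewrite -[2]/(2%:~R) -!intrM ler_int ltr_int => le_x lt_x _.
have jN : (absz j <= N)%N by rewrite /N; nia.
apply/mapP; exists (absz (j + N%:Z)%R); first by rewrite mem_iota; lia.
by lia.
Qed.

(* Main.v *)
(** Write [b n t] for [binom n (floor ((n + t) / 2))].  Pascal's rule reads
    [b (n + 1) t = b n (t + 1) + b n (t - 1)] for either parity of [n + t], so
    the shift [E] in [n] acts on [b] as [T + T^-1], where [T] is the shift in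
    [t].  Since [L_m(T + T^-1, -1) = T^m + T^-m], applying [L_m(E, -1)] replaces
    [k] by [k + m] and [k - m] in [a(n, m, k, z)] and adds the results;
    reindexing the sum over [j] shows that these are [z a] and [z^-1 a]. *)
Require Import Defs.
From mathcomp Require Import all_boot all_order all_algebra.
From mathcomp Require Import complex.
From mathcomp Require Import all_reals.
From mathcomp Require Import all_classical.
From mathcomp Require Import zify ring.
Import Order.TTheory GRing.Theory Num.Theory.
Local Open Scope ring_scope.

(** The size of a sum of polynomials depends on cancellation, so linearity in [p] is proved over a
    common range [N]; the extra coefficients vanish. *)
Lemma shift_op_widen (A : comNzRingType) (p : {poly A}) (f : nat -> A) (n N : nat) :
  (size p <= N)%N -> shift_op p f n = \sum_(i < N) p`_i * f (n + i)%N.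
Proof.
move=> le_pN; rewrite /shift_op (big_ord_widen N (fun i => p`_i * f (n + i)%N)) //.
rewrite big_mkcond /=; apply: eq_bigr => i _; case: ltnP => // le_pi.
by rewrite nth_default // mul0r.
Qed.

Lemma shift_opD (A : comNzRingType) (p q : {poly A}) (f : nat -> A) (n : nat) :
  shift_op (p + q) f n = shift_op p f n + shift_op q f n.
Proof.
pose N := maxn (size p) (size q).
rewrite !(@shift_op_widen _ _ _ _ N) ?leq_maxl ?leq_maxr ?size_polyD //.
by rewrite -big_split; apply: eq_bigr => i _; rewrite coefD mulrDl.
Qed.

Lemma shift_opN (A : comNzRingType) (p : {poly A}) (f : nat -> A) (n : nat) :
  shift_op (- p) f n = - shift_op p f n.
Proof.
rewrite /shift_op size_polyN -sumrN.
by apply: eq_bigr => i _; rewrite coefN mulNr.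
Qed.

Lemma shift_opC (A : comNzRingType) (c : A) (f : nat -> A) (n : nat) :
  shift_op c%:P f n = c * f n.
Proof.
rewrite (@shift_op_widen _ _ _ _ 1) ?size_polyC_leq1 //.
by rewrite big_ord1 coefC addn0.
Qed.

Lemma shift_opXM (A : comNzRingType) (p : {poly A}) (f : nat -> A) (n : nat) :
  shift_op ('X * p) f n = shift_op p f n.+1.
Proof.
rewrite (@shift_op_widen _ ('X * p) _ _ (size p).+1); last first.
  by rewrite mulrC; apply: leq_trans (size_polyMleq _ _) _; rewrite size_polyX addn2.
rewrite big_ord_recl coefXM mul0r add0r; apply: eq_bigr => i _.
by rewrite coefXM /= addSnnS.
Qed.

Lemma lucasSS (A : comNzRingType) (x s : A) (n : nat) :
  lucas x s n.+2 = x * lucas x s n.+1 + s * lucas x s n.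
Proof. by []. Qed.

(** With [T] the shift in [k], the hypothesis says that [E] acts as [T + T^-1], and [T^m + T^-m]
    obeys the Lucas recurrence: [(T + T^-1)(T^(m+1) + T^-(m+1))] exceeds [T^(m+2) + T^-(m+2)] by
    exactly [T^m + T^-m]. The recurrence has order two, so the induction carries two consecutive
    indices. *)
Lemma shift_op_lucas (A : comNzRingType) (f : nat -> int -> A) :
  (forall n k, f n.+1 k = f n (k + 1) + f n (k - 1)) ->
  forall m n k, shift_op (lucas 'X (-1) m) (f ^~ k) n
              = f n (k + m%:Z) + f n (k - m%:Z).
Proof.
move=> fS m; have [] : (forall n k, shift_op (lucas 'X (-1) m) (f ^~ k) n
      = f n (k + m%:Z) + f n (k - m%:Z)) /\
   (forall n k, shift_op (lucas 'X (-1) m.+1) (f ^~ k) n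
      = f n (k + m.+1%:Z) + f n (k - m.+1%:Z)); last by [].
elim: m => [|m [IHm IHm1]]; split=> // n k.
- rewrite /= -polyC_natr shift_opC.
  have -> : k + 0%:Z = k by lia.
  by ring.
- by rewrite /= -['X]mulr1 shift_opXM -polyC1 shift_opC mul1r fS.
- rewrite lucasSS mulN1r shift_opD shift_opN shift_opXM IHm1 IHm !fS.
  have -> : k + m.+1%:Z + 1 = k + m.+2%:Z by lia.
  have -> : k + m.+1%:Z - 1 = k + m%:Z by lia.
  have -> : k - m.+1%:Z + 1 = k - m%:Z by lia.
  have -> : k - m.+1%:Z - 1 = k - m.+2%:Z by lia.
  by ring.
Qed.

Lemma binzS (n : nat) (i : int) : binz n.+1 i = (binz n i + binz n (i - 1))%N.
Proof.
case: i => [[|i]|i] //; first by rewrite /= !bin0.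
by have -> : Posz i.+1 - 1 = i by lia.
Qed.

(** A sum with infinite support is 0 by convention, so additivity is obtained on the union [D] of
    the two supports, which is finite. *)
Lemma fsumrD (V : nmodType) (I : choiceType) (f g : I -> V) :
  finite_set [set i | f i != 0] -> finite_set [set i | g i != 0] ->
  \sum_(i \in [set: I]) (f i + g i)
    = \sum_(i \in [set: I]) f i + \sum_(i \in [set: I]) g i.
Proof.
move=> fin_f fin_g; pose D := ([set i | f i != 0] `|` [set i | g i != 0])%classic.
have suppE (h : I -> V) : (forall i, ~ D i -> h i = 0) ->
    \sum_(i \in [set: I]) h i = \sum_(i \in D) h i.
  by move=> h0; apply/esym/fsbig_widen => // i [_ /h0].
have f0 i : ~ D i -> f i = 0 by move=> nDi; apply: contra_notP nDi => /eqP; left.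
have g0 i : ~ D i -> g i = 0 by move=> nDi; apply: contra_notP nDi => /eqP; right.
rewrite !suppE // => [|i nDi]; last by rewrite f0 // g0 // addr0.
by apply: fsbig_split; rewrite finite_setU.
Qed.

Section LucasBinom.
Variables (F : fieldType) (m : nat) (z : F).

Lemma lucas_binom_termS (n : nat) (k j : int) :
  lucas_binom_term m k z n.+1 j
    = lucas_binom_term m (k + 1) z n j + lucas_binom_term m (k - 1) z n j.
Proof.
rewrite /lucas_binom_term -mulrDr; congr (_ * _).
rewrite binzS natrD; congr ((binz n _)%:R + (binz n _)%:R).
  by congr (Num.floor (_%:~R / _)); lia.
(* The lower index of Pascal's rule: the integer [-1] moves inside the floor, where it lowers the
   numerator by 2. No case split on parity arises. *)
rewrite -[- 1 in LHS](@intrKfloor rat).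
rewrite -floorDrz ?rpredN ?intr_int //; congr Num.floor.
have -> : n%:Z - m%:Z * j + (k - 1) = n.+1%:Z - m%:Z * j + k - 2 by lia.
by rewrite (rmorphB _ _ 2) mulrBl divff.
Qed.

Hypothesis m_gt0 : (0 < m)%N.

Lemma lucas_binomS (n : nat) (k : int) :
  lucas_binom m k z n.+1 = lucas_binom m (k + 1) z n + lucas_binom m (k - 1) z n.
Proof.
rewrite /lucas_binom -fsumrD; try exact: lucas_binom_term_finite.
by apply: eq_fsbigr => j _; exact: lucas_binom_termS.
Qed.

Hypothesis z_neq0 : z != 0.

(** Substituting [j + 1] for [j] absorbs the [m] added to [k] and turns [z ^ j] into [z * z ^ j]. *)
Lemma lucas_binom_addm (n : nat) (k : int) :
  lucas_binom m (k + m%:Z) z n = z * lucas_binom m k z n.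
Proof.
rewrite /lucas_binom mulr_fsumr.
rewrite (reindex_fsbigT (fun j : int => j + 1)) /=; last first.
  by exists (fun j => j - 1) => j; [exact: addrK | exact: subrK].
apply: eq_fsbigr => j _; rewrite /lucas_binom_term mulrA.
rewrite expfzDr // expr1z [z * _]mulrC; congr (_ * (binz n _)%:R).
by congr (Num.floor (_%:~R / _)); ring.
Qed.

End LucasBinom.

Theorem theorem3 (R : realType) (m : nat) (k : int) (z : R[i])
    (hm : (1 <= m)%N) (hz : z != 0) (n : nat) :
  shift_op (lucas 'X (-1) m) (lucas_binom m k z) n
    - (z + z^-1) * lucas_binom m k z n = 0.
Proof.
have step n' k' := @lucas_binomS _ m z hm n' k'.
rewrite (@shift_op_lucas _ (fun n k => lucas_binom m k z n) step).
(* Writing [k] as [k - m + m] in the [z^-1] term lets the same lemma, used at [k - m], settle the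
   downward shift. *)
rewrite lucas_binom_addm // mulrDl -[X in z^-1 * lucas_binom _ X _ _](subrK m%:Z).
by rewrite lucas_binom_addm // mulKf // subrr.
Qed.
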